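(* Let $D\subseteq X$ be a nonempty $\tau_X$-open set, let $T:D\to Y$ be a single-valued mapping, and let $\bar x\in D$. Suppose $T$ is Fréchet differentiable at $\bar x$ with Fréchet derivative $\nabla T(\bar x)$. Let $v\in X\setminus\{\theta_X\}$. If $(X,\tau_X)$ is seminorm constructed and $\sup\{p(v):p\in\mathbb{F}_X\}<\infty$, then $T$ is Gâteaux directionally differentiable at $\bar x$ along the direction $v$ and $T'(\bar x,v)=\nabla T(\bar x)(v)$.
   Context: An $F$-seminorm on a real vector space $X$ is a map $p:X\to[0,\infty)$ with $p(x+y)\le p(x)+p(y)$; $p(ax)\le p(x)$ for all scalars $|a|\le 1$; and $p(a_nx)\to0$ for every $x\in X$ and every sequence of positive numbers $a_n\to 0$. It is positive if it is not identically $0$. A topology $\tau_X$ is induced by a family $\mathbb{F}_X$ of $F$-seminorms if for every $x_0\in X$ the sets $\{x\in X:\max\{p(x-x_0):p\in I\}<\lambda\}$, with $I\subseteq\mathbb{F}_X$ nonempty finite and $\lambda>0$, form a base of $\tau_X$-open neighborhoods of $x_0$. $\mathcal{F}_X$ denotes the collection of nonempty finite subsets of $\mathbb{F}_X$. $(X,\tau_X)$ and $(Y,\tau_Y)$ are real Hausdorff topological vector spaces with origins $\theta_X,\theta_Y$, whose topologies are induced by families $\mathbb{F}_X$ and $\mathbb{F}_Y$ of positive $F$-seminorms. $(X,\tau_X)$ is seminorm constructed if $\mathbb{F}_X$ (the family inducing $\tau_X$) consists of seminorms. Fréchet differentiability: $T$ is Fréchet differentiable at $\bar x$ with Fréchet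 derivative $\nabla T(\bar x)$ if $\nabla T(\bar x):X\to Y$ is a continuous linear mapping such that for every $J\in\mathcal{F}_Y$ and $\varepsilon>0$ there are $I\in\mathcal{F}_X$ and $\delta>0$ (with $\bar x+u\in D$ whenever $\max\{p(u):p\in I\}<\delta$) such that for all $u\in X$: (DZ) if $\max\{p(u):p\in I\}=0$ then $\max\{q(T(\bar x+u)-T(\bar x)-\nabla T(\bar x)(u)):q\in J\}=0$; and (DR) if $0<\max\{p(u):p\in I\}<\delta$ then $\max\left\{q\left(\frac{T(\bar x+u)-T(\bar x)-\nabla T(\bar x)(u)}{\max\{p(u):p\in I\}}\right):q\in J\right\}<\varepsilon$. Gâteaux directional differentiability: $T$ is Gâteaux directionally differentiable at $\bar x$ along $v\ne\theta_X$ with derivative $T'(\bar x,v)\in Y$ if for every $J\in\mathcal{F}_Y$ and $\varepsilon>0$ there is $\delta>0$ (with $\bar x+tv\in D$ for $|t|<\delta$) such that $0<|t|<\delta$ implies $\max\left\{q\left(\frac{T(\bar x+tv)-T(\bar x)-tT'(\bar x,v)}{t}\right):q\in J\right\}<\varepsilon$. *)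

(* Defs.v *)
From HB Require Import structures.
From mathcomp Require Import all_boot all_order all_algebra finmap.
From mathcomp Require Import all_classical all_reals all_analysis.
Export numFieldTopology.Exports.

Set Implicit Arguments.
Unset Strict Implicit.
Unset Printing Implicit Defensive.

Import Order.TTheory GRing.Theory Num.Theory.

Local Open Scope classical_set_scope.
Local Open Scope ring_scope.

Definition F_seminorm (R : realType) (X : lmodType R) (p : X -> R) : Prop :=
  [/\ forall x, 0 <= p x,
      forall x y, p (x + y) <= p x + p y,
      forall (a : R) x, `|a| <= 1 -> p (a *: x) <= p x
    & forall x (a : R^nat), (forall n, 0 < a n) ->
        a @ \oo --> (0 : R) -> (fun n => p (a n *: x)) @ \oo --> (0 : R)].

Definition positive_F_seminorm (R : realType) (X : lmodType R) (p : X -> R)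
    : Prop :=
  F_seminorm p /\ exists x, p x != 0.

Definition seminorm (R : realType) (X : lmodType R) (p : X -> R) : Prop :=
  [/\ forall x, 0 <= p x,
      forall x y, p (x + y) <= p x + p y
    & forall (a : R) x, p (a *: x) = `|a| * p x].

Definition fin_subfamilies (R : realType) (X : lmodType R)
    (FX : set (X -> R)) : set {fset (X -> R)} :=
  [set I | [set` I] `<=` FX /\ [set` I] !=set0].

(* The default value 0 plays no role: it is only used with nonempty sets I of
   nonnegative functions, for which this is the maximum of the p x. *)
Definition max_at (R : realType) (X : lmodType R) (I : {fset (X -> R)})
    (x : X) : R :=
  \big[Num.max/0]_(p <- I) p x.

Definition family_ball (R : realType) (X : lmodType R) (I : {fset (X -> R)})
    (x0 : X) (lambda : R) : set X :=
  [set x | max_at I (x - x0) < lambda].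

Definition topology_induced_by (R : realType) (X : topologicalLmodType R)
    (FX : set (X -> R)) : Prop :=
  forall x0 : X,
    (forall I lambda, fin_subfamilies FX I -> 0 < lambda ->
       open_nbhs x0 (family_ball I x0 lambda)) /\
    (forall U, nbhs x0 U -> exists I lambda,
       [/\ fin_subfamilies FX I, 0 < lambda
         & family_ball I x0 lambda `<=` U]).

Definition seminorm_constructed (R : realType) (X : lmodType R)
    (FX : set (X -> R)) : Prop :=
  forall p, FX p -> seminorm p.

(* A map D -> Y is represented by a total T : X -> Y. The inclusions in D below
   ensure that only values of T on D are used. *)
Definition is_frechet_derivative (R : realType) (X Y : topologicalLmodType R)
    (FX : set (X -> R)) (FY : set (Y -> R)) (D : set X) (T : X -> Y)
    (xbar : X) (L : {linear X -> Y}) : Prop :=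
  continuous L /\
  forall J (eps : R), fin_subfamilies FY J -> 0 < eps ->
    exists I (delta : R),
      [/\ fin_subfamilies FX I,
          0 < delta,
          forall u : X, max_at I u < delta -> D (xbar + u),
          forall u : X, max_at I u = 0 ->
            max_at J (T (xbar + u) - T xbar - L u) = 0
        & forall u : X, 0 < max_at I u < delta ->
            max_at J ((max_at I u)^-1 *: (T (xbar + u) - T xbar - L u)) < eps].

Definition is_gateaux_derivative (R : realType) (X Y : topologicalLmodType R)
    (FY : set (Y -> R)) (D : set X) (T : X -> Y) (xbar v : X) (w : Y) : Prop :=
  forall J (eps : R), fin_subfamilies FY J -> 0 < eps ->
    exists delta : R,
      [/\ 0 < delta,
          forall t : R, `|t| < delta -> D (xbar + t *: v)
        & forall t : R, 0 < `|t| < delta ->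
            max_at J (t^-1 *: (T (xbar + t *: v) - T xbar - t *: w)) < eps].

(* Main.v *)
(* F-seminorms are not homogeneous, but subadditivity gives
   q (a z) <= n q z whenever |a| <= n. With m the maximum of p v over the finite
   set I, the Gateaux quotient at t is, up to sign, m times the Frechet quotient
   at u = t v. The Frechet estimate is thus needed with eps / n for some n >= m;
   as I depends on the chosen precision, n must bound p v over the whole
   family, which is what the finite supremum provides. *)

Require Import Defs.
From HB Require Import structures.
From mathcomp Require Import all_boot all_order all_algebra finmap.
From mathcomp Require Import all_classical all_reals all_analysis.

Set Implicit Arguments.
Unset Strict Implicit.
Unset Printing Implicit Defensive.

Import Order.TTheory GRing.Theory Num.Theory.

Local Open Scope classical_set_scope.
Local Open Scope ring_scope.

(** The vector [a *: x] is a sum of [n.+1] copies of [(a / n.+1%:R) *: x], whose coefficient has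
    modulus at most 1. *)
Lemma F_seminorm_scale_le (R : realType) (X : lmodType R) (p : X -> R)
    (n : nat) (a : R) (x : X) :
  F_seminorm p -> `|a| <= n.+1%:R -> p (a *: x) <= n.+1%:R * p x.
Proof.
move=> [_ pD pZ _] an.
have pMn k y : p (y *+ k.+1) <= k.+1%:R * p y.
  elim: k => [|k IHk]; first by rewrite mulr1n mul1r.
  rewrite mulrS (le_trans (pD _ _))// [in leRHS]mulrS mulrDl mul1r.
  by rewrite lerD2l.
have -> : a *: x = ((a / n.+1%:R) *: x) *+ n.+1.
  by rewrite -scaler_nat scalerA mulrC divfK// pnatr_eq0.
apply: (le_trans (pMn _ _)); rewrite ler_wpM2l//; apply: pZ.
by rewrite normrM normfV normr_nat ler_pdivrMr ?mul1r// ltr0n.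
Qed.

Section max_at.
Context (R : realType) (X : lmodType R).
Implicit Types (I : {fset (X -> R)}) (x : X).

Lemma max_at_ge0 I x : 0 <= max_at I x.
Proof. exact: bigmax_ge_id. Qed.

Lemma max_at_le I x c :
  0 <= c -> (forall p, p \in I -> p x <= c) -> max_at I x <= c.
Proof. by move=> c0 pc; rewrite /max_at big_seq; exact: bigmax_le. Qed.

Lemma le_max_at I x p : p \in I -> p x <= max_at I x.
Proof. by move=> pI; exact: (le_bigmax_seq 0 p xpredT (fun q => q x)). Qed.

Lemma max_at_scale I a x :
  (forall p, p \in I -> seminorm p) -> max_at I (a *: x) = `|a| * max_at I x.
Proof.
move=> semI; rewrite /max_at !big_seq.
apply: (big_ind2 (fun y z => y = `|a| * z)); first by rewrite mulr0.
  by move=> _ y _ z -> ->; rewrite maxr_pMr.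
by move=> p /semI[].
Qed.

Lemma max_at_scale_le I n a x :
  (forall p, p \in I -> F_seminorm p) -> `|a| <= n.+1%:R ->
  max_at I (a *: x) <= n.+1%:R * max_at I x.
Proof.
move=> FI an; apply: max_at_le => [|p pI]; first by rewrite mulr_ge0 ?max_at_ge0.
apply: (le_trans (F_seminorm_scale_le x (FI _ pI) an)).
by rewrite ler_wpM2l// le_max_at.
Qed.

End max_at.

Lemma ereal_sup_lty_nat_ub (R : realType) (T : Type) (A : set T) (f : T -> R) :
  (ereal_sup [set (f i)%:E | i in A] < +oo)%E ->
  exists n : nat, forall i, A i -> f i <= n.+1%:R.
Proof.
move=> supA; set s := ereal_sup _ in supA.
exists (Num.truncn (fine s)) => i Ai.
have fis : ((f i)%:E <= s)%E by apply: ereal_sup_ubound; exists i.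
(* The member [i] of [A] rules out the value [-oo], so an empty [A] needs no separate case. *)
have sfin : s \is a fin_num.
  by rewrite fin_numE -ltNye -ltey supA (lt_le_trans (ltNyr (f i)) fis).
rewrite -(fineK sfin) lee_fin in fis.
by rewrite (le_trans fis)// ltW// truncnS_gt.
Qed.

Theorem theorem4p18 (R : realType) (X Y : topologicalLmodType R)
  (FX : set (X -> R)) (FY : set (Y -> R))
  (hausX : hausdorff_space X) (hausY : hausdorff_space Y)
  (posFX : forall p, FX p -> positive_F_seminorm p)
  (posFY : forall q, FY q -> positive_F_seminorm q)
  (indX : topology_induced_by FX) (indY : topology_induced_by FY)
  (D : set X) (D0 : D !=set0) (openD : open D)
  (T : X -> Y) (xbar : X) (Dxbar : D xbar)
  (L : {linear X -> Y}) (frechetT : is_frechet_derivative FX FY D T xbar L)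
  (v : X) (v0 : v != 0)
  (semX : seminorm_constructed FX)
  (supv : (ereal_sup [set (p v)%:E | p in FX] < +oo)%E) :
  is_gateaux_derivative FY D T xbar v (L v).
Proof.
move=> J eps FJ eps0.
have [n vn] := ereal_sup_lty_nat_ub supv.
have epsn0 : 0 < eps / n.+1%:R by rewrite divr_gt0.
have [_ /(_ J _ FJ epsn0)[I [delta [FI delta0 ID IZ IR]]]] := frechetT.
have FsemJ q : q \in J -> F_seminorm q
    by move=> qJ; have [] := posFY _ (FJ.1 q qJ).
have semI p : p \in I -> seminorm p by move=> pI; apply: semX; exact: FI.1.
set m := max_at I v.
have m0 : 0 <= m by exact: max_at_ge0.
have mn : m <= n.+1%:R by apply: max_at_le => // p pI; apply: vn; exact: FI.1.
have m1 : 0 < m + 1 by rewrite ltr_wpDl.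
have tvE t : max_at I (t *: v) = `|t| * m by exact: max_at_scale.
have tv_lt t : `|t| < delta / (m + 1) -> max_at I (t *: v) < delta.
  rewrite tvE ltr_pdivlMr//; apply: le_lt_trans.
  by rewrite ler_wpM2l// lerDl.
(* Dividing by [m + 1] rather than [m] keeps the radius meaningful when [m = 0]. *)
exists (delta / (m + 1)); split; first exact: divr_gt0.
  by move=> t /tv_lt /ID.
move=> t /andP[t0 /tv_lt tvd].
(* By linearity of [L], [r] is the Fréchet remainder at [u = t *: v]. *)
rewrite -linearZ; set r := _ - L _.
have [mE0|mN0] := eqVneq m 0.
  have r0 : max_at J r = 0 by apply: IZ; rewrite tvE mE0 mulr0.
  have tb : `|t^-1| <= (Num.truncn `|t^-1|).+1%:R by rewrite ltW// truncnS_gt.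
  by apply: (le_lt_trans (max_at_scale_le r FsemJ tb)); rewrite r0 mulr0.
have mp : 0 < m by rewrite lt0r mN0.
(* The outer coefficient is [m] up to the sign of [t], so its modulus is at most [n.+1%:R], the
   factor by which [eps] was divided. *)
have rE : t^-1 *: r = (t^-1 * (`|t| * m)) *: ((max_at I (t *: v))^-1 *: r).
  by rewrite scalerA tvE mulfK// mulf_neq0// gt_eqF.
have an : `|t^-1 * (`|t| * m)| <= n.+1%:R.
  by rewrite !normrM normfV normr_id mulKf ?gt_eqF// ger0_norm.
rewrite rE; apply: (le_lt_trans (max_at_scale_le _ FsemJ an)).
rewrite mulrC -ltr_pdivlMr//; apply: IR.
by rewrite tvd tvE mulr_gt0.
Qed.
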